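(* Let $1\le p<\infty$ and let $A$ be a bounded subset of $\ell^p$ with the $p$-norm. Then $A$ is Bourbaki quasi-precompact in itself if and only if for each $\varepsilon>0$ there exists $n_0\in\mathbb{N}$ such that for each $x\in A$ there exists $y_x^{\varepsilon}=(y^{\varepsilon}_{x,i})_{i\in\mathbb{N}}\in A$ such that $x$ can be joined to $y_x^{\varepsilon}$ by an $\varepsilon$-chain in $A$ and $\sum_{i>n_0}|y^{\varepsilon}_{x,i}|^p<\varepsilon^p$.
   Context: For a metric space $(M,\mu)$ and $\varepsilon>0$, an $\varepsilon$-chain from $u$ to $v$ in $M$ is a finite ordered set of points $u=u_0,u_1,\dots,u_n=v$ of $M$ with $\mu(u_{i-1},u_i)<\varepsilon$ for $i=1,\dots,n$. For $q\in M$, $B^\infty_\varepsilon(q)$ denotes the set of points of $M$ that can be joined to $q$ by an $\varepsilon$-chain in $M$. $M$ is Bourbaki quasi-precompact if for every $\varepsilon>0$ there are finitely many points $q_1,\dots,q_k\in M$ with $M=\bigcup_{i=1}^kB^\infty_\varepsilon(q_i)$. A subset $A$ of a metric space is Bourbaki quasi-precompact in itself if $A$, with the induced metric, is a Bourbaki quasi-precompact metric space (all chains and centres lie in $A$). *)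

(* Defs.v *)
From HB Require Import structures.
From mathcomp Require Import all_boot all_order all_algebra.
From mathcomp Require Import all_classical all_reals all_analysis.

Set Implicit Arguments.
Unset Strict Implicit.
Unset Printing Implicit Defensive.
Import Order.TTheory GRing.Theory Num.Theory.
Import numFieldNormedType.Exports.

Local Open Scope classical_set_scope.
Local Open Scope ring_scope.

Section chains.
Context {R : realType} {M : metricType R}.
Implicit Types (e : R) (u v q : M).

Definition eps_chain e u v :=
  exists s : seq M, path (fun a b => mdist a b < e) u s /\ last u s = v.

Definition chain_ball e q : set M := [set x | eps_chain e x q].

End chains.

(* The list of centres may be empty, so the empty space qualifies. *)
Definition bourbaki_quasi_precompact {R : realType} (M : metricType R) :=
  forall e : R, 0 < e ->
    exists s : seq M, [set: M] = \bigcup_(q in [set` s]) chain_ball e q.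

Section induced_metric.
Context {R : realType} {M : metricType R} (A : set M).

Let dist (x y : A) : R := mdist (set_val x) (set_val y).

Let dist_ge0 x y : 0 <= dist x y.
Proof. exact: mdist_ge0. Qed.

Let dist_positivity x y : dist x y = 0 -> x = y.
Proof. by move=> /mdist_positivity /val_inj. Qed.

Let ballEdist (x : A) (d : R) : ball x d = [set y | dist x y < d].
Proof.
apply/seteqP; split=> y; rewrite /ball/= /initial_ball /dist.
  by rewrite ballEmdist.
by rewrite ballEmdist.
Qed.

HB.instance Definition _ :=
  @PseudoMetric_isMetric.Build R A dist dist_ge0 dist_positivity ballEdist.

End induced_metric.

Lemma mdist_subE {R : realType} {M : metricType R} (A : set M) (x y : A) :
  mdist x y = mdist (set_val x) (set_val y).
Proof. by []. Qed.

(* Sequences are 0-indexed. LfunType is not quotiented by equality almost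
   everywhere, so its elements are exactly the p-summable sequences (see
   ellp_summableP), and the p-norm is definite on them because only the empty set
   is null for the counting measure. *)
Definition ellp {R : realType} {p : R} (p1 : 1 <= p) : Type :=
  @LfunType _ nat R counting p%:E p1.

Section ellp_structure.
Context {R : realType} {p : R} (p1 : 1 <= p).

Local Notation L := (@LfunType _ nat R counting p%:E p1).

HB.instance Definition _ := GRing.Lmodule.on (ellp p1).

Definition coord (x : ellp p1) : nat -> R := (x : L).

Definition ellp_norm (x : ellp p1) : R :=
  fine ('N[counting]_p%:E[EFin \o coord x])%E.

Let ellp_normD (x y : ellp p1) :
  ellp_norm (x + y) <= ellp_norm x + ellp_norm y.
Proof. exact: (@ler_LnormD _ nat R counting _ _ (x : L) (y : L)). Qed.

Let ellp_normZ (l : R) (x : ellp p1) :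
  ellp_norm (l *: x) = `|l| * ellp_norm x.
Proof.
apply: EFin_inj; rewrite EFinM /ellp_norm.
rewrite (finite_norm_fine (l *: x : L)) (finite_norm_fine (x : L)).
exact: (@LnormZ _ nat R counting _ _ (x : L)).
Qed.

Let ellp_norm0_eq0 (x : ellp p1) : ellp_norm x = 0 -> x = 0.
Proof.
move=> /(@fine_Lnormr_eq0 _ nat R counting _ _ (x : L)) [N [mN N0 xN]].
apply/LfuneqP => i; apply: contrapT => xi0.
have Ni : N i by apply: xN => /= /(_ I).
have : counting [set i] = 0 :> \bar R.
  apply/eqP; rewrite eq_le measure_ge0 andbT -N0.
  by apply: le_measure; rewrite ?inE// => _ ->.
by rewrite /counting asboolT// fset_set1 finmap.cardfs1 => /eqP; rewrite eqe oner_eq0.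
Qed.

HB.instance Definition _ := @Lmodule_isNormed.Build R (ellp p1)
  ellp_norm ellp_normD ellp_normZ ellp_norm0_eq0.

Let dist (x y : ellp p1) : R := `|x - y|.

Let dist_ge0 x y : 0 <= dist x y.
Proof. exact: normr_ge0. Qed.

Let dist_positivity x y : dist x y = 0 -> x = y.
Proof. by move=> /normr0_eq0/eqP; rewrite subr_eq0 => /eqP. Qed.

Let ballEdist (x : ellp p1) (d : R) : ball x d = [set y | dist x y < d].
Proof. by rewrite -ball_normE. Qed.

HB.instance Definition _ := @PseudoMetric_isMetric.Build R (ellp p1)
  dist dist_ge0 dist_positivity ballEdist.

End ellp_structure.

Coercion coord : ellp >-> Funclass.

Lemma ellp_mdistE {R : realType} {p : R} (p1 : 1 <= p) (x y : ellp p1) :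
  mdist x y = `|x - y|.
Proof. by []. Qed.

Lemma coordB {R : realType} {p : R} (p1 : 1 <= p) (x y : ellp p1) i :
  (x - y) i = x i - y i.
Proof. by []. Qed.

Lemma ellp_normE {R : realType} {p : R} (p1 : 1 <= p) (x : ellp p1) :
  (`|x|%:E = (\sum_(k <oo) (`|x k| `^ p)%:E) `^ p^-1)%E.
Proof.
have p0 : 0 < p := lt_le_trans ltr01 p1.
transitivity ('N[counting]_p%:E[EFin \o x])%E.
  exact: (@finite_norm_fine _ nat R counting p%:E p1 x).
by rewrite Lnorm_counting.
Qed.

Lemma ellp_summableP {R : realType} {p : R} (p1 : 1 <= p) (f : nat -> R) :
  (exists x : ellp p1, f = x) <-> (\sum_(k <oo) (`|f k| `^ p)%:E < +oo)%E.
Proof.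
have p0 : 0 < p := lt_le_trans ltr01 p1.
have nE : ('N[counting]_p%:E[EFin \o f] =
    (\sum_(k <oo) (`|f k| `^ p)%:E) `^ p^-1)%E by rewrite Lnorm_counting.
split=> [[x fx]|sf].
  have : ('N[counting]_p%:E[EFin \o f] < +oo)%E.
    by rewrite fx; exact: (@Lfunction_finite _ nat R counting p%:E p1).
  rewrite nE => /lty_poweRy; apply; rewrite ?invr_eq0 ?gt_eqF//.
have fL : f \in Lfun (counting : set nat -> \bar R) p%:E.
  rewrite inE; apply/andP; split; rewrite inE//=.
  by rewrite /finite_norm nE poweR_lty.
by exists (@Lfun_Sub _ nat R counting p%:E p1 f fL).
Qed.

(* Main.v *)
(** Forward direction: take as $y_x$ one of the finitely many centres, whose
    tails are uniformly small. Conversely, apply the condition with [e / 8] and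
    group the points $y_x$ according to the cell of a fine grid that contains
    their first $n_0 + 1$ coordinates. Since [A] is bounded there are finitely
    many cells, and two points $y_x$ in the same cell are at distance less than
    [e], because their heads are close and both tails are small. One
    representative per cell therefore suffices as a centre. *)
Require Import Defs.
From mathcomp Require Import all_boot all_order all_algebra.
From mathcomp Require Import all_classical all_reals all_analysis.
From mathcomp Require Import ring lra.

Set Implicit Arguments.
Unset Strict Implicit.
Unset Printing Implicit Defensive.
Import Order.TTheory GRing.Theory Num.Theory.
Import numFieldNormedType.Exports.

Local Open Scope classical_set_scope.
Local Open Scope ring_scope.

Lemma eps_chainW (R : realType) (M : metricType R) (d e : R) (u v : M) :
  d <= e -> eps_chain d u v -> eps_chain e u v.
Proof.
move=> de [s [us <-]]; exists s; split=> //.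
by apply: sub_path us => a b /= /lt_le_trans; apply.
Qed.

Lemma eps_chain_rcons (R : realType) (M : metricType R) (e : R) (u v w : M) :
  eps_chain e u v -> mdist v w < e -> eps_chain e u w.
Proof.
move=> [s [us <-]] vw; exists (rcons s w).
by rewrite last_rcons rcons_path us.
Qed.

(** Choose one point in each nonempty fibre. The choice has values in [option T], with [None] for
    the empty fibres, because [T] itself may be empty. *)
Lemma finite_fiber_representatives (T : choiceType) (F : finType) (f : T -> F) :
  exists s : seq T, forall x, exists2 q, q \in s & f q = f x.
Proof.
have /choice[g gP] c : exists o : option T,
    forall x, f x = c -> exists2 q, o = Some q & f q = c.
  have [[x <-]|nx] := pselect (exists x, f x = c).
    by exists (Some x) => _ _; exists x.
  by exists None => x xc; case: nx; exists x.
exists (pmap g (enum F)) => x.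
have [q gq fq] := gP _ x erefl; exists q => //.
by rewrite mem_pmap -gq map_f// mem_enum.
Qed.

(** By symmetry [b] may be taken smaller in absolute value, and then [|a - b|] is at most
    [2 * |a|]. *)
Lemma powR_normB_le (R : realType) (p a b : R) : 0 <= p ->
  `|a - b| `^ p <= 2 `^ p * (`|a| `^ p + `|b| `^ p).
Proof.
move=> p0; wlog ba : a b / `|b| <= `|a| => [wl|].
  have [ba|/ltW ab] := leP `|b| `|a|; first exact: wl.
  by rewrite distrC [X in _ * X]addrC; exact: wl.
apply: (@le_trans _ _ ((2 * `|a|) `^ p)).
  apply: ge0_ler_powR => //; rewrite ?nnegrE ?mulr_ge0//.
  by apply: le_trans (ler_normB _ _) _; lra.
by rewrite powRM// ler_wpM2l ?powR_ge0// lerDl powR_ge0.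
Qed.

Section ellp_norm.
Context {R : realType} {p : R} (p1 : 1 <= p).
Implicit Types x y : ellp p1.
Local Open Scope ereal_scope.

Let p_gt0 : (0 < p)%R. Proof. exact: lt_le_trans p1. Qed.

Lemma ellp_norm_powR x : (`|x| `^ p)%:E = \sum_(k <oo) (`|x k| `^ p)%:E.
Proof.
rewrite -poweR_EFin ellp_normE -poweRrM mulVf ?gt_eqF// poweRe1//.
by apply: nneseries_ge0 => k _ _; rewrite lee_fin powR_ge0.
Qed.

Lemma ellp_coord_le x i : (`|x i| <= `|x|)%R.
Proof.
rewrite leNgt; apply/negP => xi.
have /(gt0_ltr_powR p_gt0) : (`|x| < `|x i|)%R by [].
rewrite !nnegrE => /(_ (normr_ge0 _) (normr_ge0 _)).
rewrite ltNge -lee_fin ellp_norm_powR => /negP; apply.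
apply: le_trans (@nneseries_lim_ge _ _ xpredT 0%N i.+1 _); last first.
  by move=> *; rewrite lee_fin powR_ge0.
by rewrite big_nat_recr//= leeDr// sume_ge0// => *; rewrite lee_fin powR_ge0.
Qed.

(** Tails of a convergent series tend to 0, and finitely many eventual bounds hold
    simultaneously. *)
Lemma ellp_tail_small (s : seq (ellp p1)) (e : R) : (0 < e)%R ->
  exists n, forall x, x \in s -> \sum_(n.+1 <= i <oo) (`|x i| `^ p)%:E < e%:E.
Proof.
move=> e0.
have tail x : \forall n \near \oo, \sum_(n <= i <oo) (`|x i| `^ p)%:E < e%:E.
  have : \sum_(k <oo) (`|x k| `^ p)%:E < +oo by rewrite -ellp_norm_powR ltry.
  move=> /nneseries_tail_cvg tx.
  have /tx : forall k : nat, xpredT k -> 0 <= (`|x k| `^ p)%:E.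
    by move=> k _; rewrite lee_fin powR_ge0.
  move=> /(_ [set z | z < e%:E]); apply.
  by apply: open_nbhs_nbhs; split; [exact: open_ereal_lt_ereal|rewrite /= lte_fin].
have [N _ NP] : \forall n \near \oo, forall x, x \in s ->
    \sum_(n <= i <oo) (`|x i| `^ p)%:E < e%:E.
  elim: s => [|x s ih]; first by apply: nearW => n x; rewrite in_nil.
  near=> n => y; rewrite in_cons => /predU1P[->|ys]; first by near: n.
  by move: y ys; near: n.
by exists N; apply: NP => /=.
Unshelve. all: by end_near. Qed.

(** Head and tail of [x - y] each contribute at most [(e / 2) ^ p], the tail strictly less, and
    [2 <= 2 ^ p] bounds the total by [e ^ p]. *)
Lemma ellp_dist_lt (N : nat) (e : R) x y : (0 < e)%R ->
  (forall i, (i < N)%N -> `|x i - y i| <= e / (2 * N%:R))%R ->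
  \sum_(N <= i <oo) (`|x i| `^ p)%:E < ((e / 8) `^ p)%:E ->
  \sum_(N <= i <oo) (`|y i| `^ p)%:E < ((e / 8) `^ p)%:E ->
  (`|x - y| < e)%R.
Proof.
move=> e0 xyN tx ty; rewrite ltNge; apply/negP => exy.
have : ((e `^ p)%:E <= (`|x - y| `^ p)%:E).
  by rewrite lee_fin ge0_ler_powR ?nnegrE ?(ltW p_gt0) ?(ltW e0).
(* With [e / 8] as unit, [(e / 2) ^ p] and [e ^ p] become [c ^ 2 * t] and [c ^ 3 * t], so the final
   estimates only need [2 <= c]. *)
set t := ((e / 8) `^ p)%R in tx ty; pose c : R := (2 `^ p)%R.
have c2 : (2 <= c)%R by rewrite /c le1r_powR//; lra.
have t0 : (0 < t)%R by rewrite powR_gt0//; lra.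
have h2 : ((e / 2) `^ p = c * (c * t))%R.
  by rewrite /c /t -!powRM; [congr (_ `^ _)%R; lra| lra..].
have h1 : (e `^ p = c * (c * (c * t)))%R.
  by rewrite -h2 /c -powRM; [congr (_ `^ _)%R; lra| lra..].
have term_ge0 (z : ellp p1) i : 0 <= (`|z i| `^ p)%:E by rewrite lee_fin powR_ge0.
apply/negP; rewrite -ltNge ellp_norm_powR (@nneseries_split _ _ 0 N); last first.
  by move=> k _; exact: (term_ge0 (x - y)%R).
rewrite add0n.
have head : \sum_(0 <= k < N) (`|(x - y) k| `^ p)%R%:E <= (c * (c * t))%:E.
  rewrite -h2 sumEFin lee_fin.
  (* For [N = 0] the head is empty. Otherwise its [N] terms are each at most [(e / (2 * N)) ^ p],
     and [N <= N ^ p]. *)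
  have [->|N0] := posnP N; first by rewrite big_geq// powR_ge0.
  have N1 : (1 <= N%:R :> R)%R by rewrite ler1n.
  have -> : (e / 2 = N%:R * (e / (2 * N%:R)))%R by field; lra.
  have q0 : (0 <= e / (2 * N%:R))%R by rewrite divr_ge0 ?mulr_ge0 ?(ltW e0).
  rewrite powRM//.
  apply: (@le_trans _ _ (\sum_(0 <= k < N) (e / (2 * N%:R)) `^ p)%R).
    rewrite !big_mkord; apply: ler_sum => k _.
    by apply: ge0_ler_powR; rewrite ?nnegrE ?(ltW p_gt0)//; exact: xyN.
  rewrite sumr_const_nat subn0 -[leLHS]mulr_natl ler_wpM2r ?powR_ge0//.
  exact: le1r_powR.
have tl : \sum_(N <= k <oo) (`|(x - y) k| `^ p)%:E < (c * (c * t))%:E.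
  apply: (@le_lt_trans _ _ (\sum_(N <= k <oo)
      (c%:E * ((`|x k| `^ p)%:E + (`|y k| `^ p)%:E)))).
    apply: lee_nneseries => k *; first exact: (term_ge0 (x - y)%R).
    by rewrite -EFinD -EFinM lee_fin coordB powR_normB_le ?(ltW p_gt0).
  rewrite nneseriesZl; last by move=> k _; rewrite adde_ge0.
  rewrite nneseriesD// EFinM lte_pmul2l//; last by rewrite lte_fin; lra.
  apply: lt_le_trans (lteD tx ty) _.
  by rewrite -EFinD lee_fin; nra.
apply: lt_le_trans (lee_ltD _ head tl) _; first by rewrite sumEFin.
rewrite -EFinD h1 lee_fin -mulr2n -mulr_natl ler_wpM2r//.
by rewrite !mulr_ge0// ?(ltW t0)//; lra.
Qed.

End ellp_norm.

Theorem theorem2p9 (R : realType) (p : R) (p1 : 1 <= p) (A : set (ellp p1))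
    (bA : bounded_set A) :
  bourbaki_quasi_precompact A <->
  forall e : R, 0 < e ->
    exists n0 : nat, forall x : A, exists y : A,
      eps_chain e x y /\
      (\sum_(n0.+1 <= i <oo) (`|set_val y i| `^ p)%:E < (e `^ p)%:E)%E.
Proof.
split=> [precA|tailA] e e0.
  have [s As] := precA e e0.
  have [n nP] := ellp_tail_small (map set_val s) (powR_gt0 p e0).
  exists n => x; have : [set: A] x by [].
  rewrite As => -[q /= qs xq]; exists q; split=> //.
  by apply: nP; exact: map_f.
have [n nP] := tailA (e / 8) (divr_gt0 e0 (ltr0Sn _ _)).
have [g gP] := choice nP.
have [B B0 AB] : exists2 B : R, 0 < B & forall x, A x -> `|x| <= B.
  (* Every real above [M] bounds [A]; this one is also positive. *)
  case: bA => M [_ MA]; exists (`|M| + 1); first by rewrite ltr_wpDl.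
  by move=> x; apply: MA; rewrite (le_lt_trans (ler_norm M))// ltrDl.
(* The mesh is the head tolerance of [ellp_dist_lt] for [N = n.+1]. *)
pose d := e / (2 * n.+1%:R).
have d0 : 0 < d by rewrite divr_gt0// mulr_gt0.
pose K := Num.truncn ((B + B) / d).
pose cell (x : A) : {ffun 'I_n.+1 -> 'I_K.+1} :=
  (* Adding [B] moves the coordinates into [[0, 2B]], so the index never exceeds [K] and the default
     value of [inord] does not occur ([cellK]). *)
  [ffun i : 'I_n.+1 => inord (Num.truncn ((set_val (g x) i + B) / d))].
have [s sP] := finite_fiber_representatives cell.
exists (map g s); apply/seteqP; split=> // x _.
have [q qs qx] := sP x; exists (g q); first exact: map_f.
have [xgx tx] := gP x; have [_ tq] := gP q.
(* The chain from [x] to [g x] is prolonged by a single jump to [g q]. *)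
apply: (@eps_chain_rcons _ _ _ _ (g x)).
  by apply: eps_chainW xgx; lra.
rewrite mdist_subE ellp_mdistE; apply: ellp_dist_lt tx tq => // i iN.
have bnd y : `|set_val (g y) i| <= B.
  by rewrite (le_trans (ellp_coord_le _ _))// AB//; exact: set_valP.
have shift_ge0 y : 0 <= (set_val (g y) i + B) / d.
  by rewrite divr_ge0 ?(ltW d0)//; have := bnd y; rewrite ler_norml; lra.
have cellK y : (Num.truncn ((set_val (g y) i + B) / d) < K.+1)%N.
  rewrite ltnS /K; apply: le_truncn; rewrite ler_wpM2r ?invr_ge0 ?(ltW d0)//.
  by have := bnd y; rewrite ler_norml; lra.
move: qx => /ffunP/(_ (Ordinal iN)); rewrite !ffunE => /(congr1 val) /=.
rewrite !inordK// => tE.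
have /andP[xl xu] := truncn_itv (shift_ge0 x).
have /andP[ql qu] := truncn_itv (shift_ge0 q).
(* Both shifted coordinates lie in the same interval [[m * d, (m + 1) * d)], hence differ by less
   than [d]. *)
rewrite -tE in xl xu; move: xl xu ql qu.
rewrite ler_pdivlMr // ltr_pdivrMr// ler_pdivlMr// ltr_pdivrMr// -/d.
move: (Num.truncn _) => m; rewrite -(natr1 m) ler_norml.
lra.
Qed.
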